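(* (1) If $G$ is a finitely generated group and $H\le G$ is a subgroup that is not locally finite, then the relative growth function $g_H^G$ is $\sim$-equivalent to a superadditive function $f:\mathbb{N}\to\mathbb{N}$. (2) If $H$ is a countably infinite and locally finite group, then there is an embedding of $H$ into a finitely generated group $G$ such that $g_H^G$ is not equivalent (in the sense of $\approx$) to any nonzero superadditive function. (3) Let $H$ be an infinite cyclic group, and let $f:\mathbb{N}\to\mathbb{N}$ be any non-zero superadditive function of at most exponential growth, i.e. $f(r)\preceq 2^r$. Then there exist a finitely generated group $G$, which can be chosen solvable, and an embedding of $H$ into $G$ such that the relative growth function $g_H^G$ of the embedding is equivalent (in the sense of $\approx$) to $f$.
   Context: $\mathbb{N}=\{1,2,\dots\}$. For a group $G$ with finite generating set $X$, $|g|_X$ denotes the word length of $g\in G$ with respect to $X$. For a subgroup $H$ of $G$ (identified with its image if $H$ is embedded in $G$), the relative growth function of $H$ in $G$ is $g_H^G:\mathbb{N}\to\mathbb{N}$, $g_H^G(r)=\#\{h\in H: |h|_X\le r\}$; it is considered up to the equivalences below, under which it does not depend on the choice of $X$. A group is locally finite if all its finitely generated subgroups are finite. A function $g:\mathbb{N}\to\mathbb{N}$ is superadditive if $g(r+s)\ge g(r)+g(s)$ for all $r,s$. For functions $f,g$ on $\mathbb{N}$: $f\sim g$ means that there is a positive integer $c$ with $f(r)\le g(cr)$ and $g(r)\le f(cr)$ for all $r\in\mathbb{N}$. $f\preceq g$ means there is a positive integer $c$ with $f(r)\le c\,g(cr)$ for all $r\in\mathbb{N}$; $f\approx g$ means $f\preceq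 g$ and $g\preceq f$. *)

(* Defs.v *)
From mathcomp Require Import all_boot.
From mathcomp Require Import finmap.
From mathcomp Require Import boolp classical_sets functions cardinality.

Set Implicit Arguments.
Unset Strict Implicit.
Unset Printing Implicit Defensive.

Local Open Scope classical_set_scope.

Section Groups.
Variable G : groupType.
Implicit Types (A X H : set G) (g : G).

(* [spelled A n] is the set of products of words of length exactly [n] in the
   letters A and A^-1. *)
Definition spelled A (n : nat) : set G :=
  [set g | exists w : seq G,
     [/\ size w = n, (forall x, x \in w -> A x \/ A (x^-1)%g) &
         (\prod_(x <- w) x)%g = g]].

(* The subgroup generated by A. *)
Definition generated A : set G := [set g | exists n, spelled A n g].

Definition finite_generating X : Prop :=
  finite_set X /\ generated X = [set: G].

(* The least length of a word spelling [g]; the default value 0 is only taken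
   when [g] lies outside the subgroup generated by X. *)
Definition word_length X g : nat :=
  xget 0 [set n | spelled X n g /\ forall m, spelled X m g -> n <= m].

(* [fset_set] sends an infinite set to the empty one, but when X is finite and
   generates G the sets below are finite. *)
Definition relative_growth X H (r : nat) : nat :=
  #|` fset_set [set h | H h /\ word_length X h <= r] |.

Definition locally_finite H : Prop :=
  forall X, finite_set X -> X `<=` H -> finite_set (generated X).

End Groups.

Definition finitely_generated (G : groupType) : Prop :=
  exists X : set G, finite_generating X.

Definition cyclic_group (G : groupType) : Prop :=
  exists a : G, generated [set a] = [set: G].

Fixpoint derived (G : groupType) (n : nat) : set G :=
  if n is m.+1 then
    generated [set c | exists x y : G,
                 [/\ derived m x, derived m y & c = [~ x, y]%g]]
  else [set: G].

Definition solvable_group (G : groupType) : Prop :=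
  exists n, @derived G n = [set 1%g].

(* A function on {1, 2, ...} is represented by a [nat -> nat] whose value at 0
   is never looked at. *)

Definition superadditive (f : nat -> nat) : Prop :=
  forall r s, 0 < r -> 0 < s -> f r + f s <= f (r + s).

Definition positive_valued (f : nat -> nat) : Prop :=
  forall r, 0 < r -> 0 < f r.

Definition nonzero_fun (f : nat -> nat) : Prop :=
  exists2 r, 0 < r & f r <> 0.

(* f ~ g *)
Definition growth_sim (f g : nat -> nat) : Prop :=
  exists2 c, 0 < c & forall r, 0 < r -> f r <= g (c * r) /\ g r <= f (c * r).

Definition growth_preceq (f g : nat -> nat) : Prop :=
  exists2 c, 0 < c & forall r, 0 < r -> f r <= c * g (c * r).

Definition growth_approx (f g : nat -> nat) : Prop :=
  growth_preceq f g /\ growth_preceq g f.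

(* Main.v *)
From HB Require Import structures.
Require Import Defs.
From mathcomp Require Import all_boot.
From mathcomp Require Import ssralg ssrnum ssrint zify.
From mathcomp Require Import finmap.
From mathcomp Require Import boolp classical_sets functions cardinality.

(* (1) If [H] is not locally finite, it contains elements of every length up to
   a bounded error, so balls of [H] can be translated into disjoint annuli; hence
   the least superadditive majorant of the relative growth function [g] is
   bounded by [g (c r)].

   (2), (3) Given a length function [L] on a set of letters [v h] with at most
   exponentially large balls, place the letters at points of the lamplighter
   group [B] at distance about [L h] from the origin and far from each other.
   This is a function [B -> K]; together with a function supported at the
   origin and the generators of [B] it generates a subgroup of the unrestricted
   wreath product of [K] and [B], whose elements at the origin include the
   commutators [v h, u].  Short words only see letters with small [L h].
   For (2), [v h] is a half-line function in [K = H wr Z] and [L] grows very fast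
   along a chain of finite subgroups, which makes the relative growth sublinear
   along a subsequence.  For (3), [L h] is about the least [r] with [|h| <= f r],
   and the letters are reflections of a dihedral group: since they are
   involutions, repeating a letter on the spot gains nothing, so lengths in [G]
   are also bounded below linearly by [L]. *)

Set Implicit Arguments.
Unset Strict Implicit.
Unset Printing Implicit Defensive.

Local Open Scope classical_set_scope.

(** * Words, word length and relative growth *)

Section WordLength.
Variable G : groupType.
Implicit Types (A X Y H : set G) (g x y : G).
Local Open Scope group_scope.

Lemma spelled1 A : spelled A 0 1.
Proof. by exists [::]; split => //; rewrite big_nil. Qed.

Lemma spelledM A m n x y :
  spelled A m x -> spelled A n y -> spelled A (m + n)%N (x * y).
Proof.
move=> [v [<- Av <-]] [w [<- Aw <-]]; exists (v ++ w).
split; rewrite ?size_cat ?big_cat // => z.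
by rewrite mem_cat => /orP[/Av|/Aw].
Qed.

Lemma spelled_letter A x : A x -> spelled A 1 x.
Proof.
by move=> Ax; exists [:: x]; split=> //; [move=> y /[!inE]/eqP->; left|rewrite big_seq1].
Qed.

Lemma spelledV A n x : spelled A n x -> spelled A n x^-1.
Proof.
move=> [w [<- Aw <-]]; exists (rev [seq y^-1 | y <- w]); split.
- by rewrite size_rev size_map.
- by move=> y; rewrite mem_rev => /mapP[z /Aw Az ->]; rewrite invgK; case: Az; [right|left].
- by rewrite -map_rev big_map prodgV revK.
Qed.

Lemma spelledS A n x y : A x \/ A x^-1 -> spelled A n y -> spelled A n.+1 (x * y).
Proof.
move=> Ax Ay; rewrite -add1n; apply: spelledM Ay.
by case: Ax => /spelled_letter // /spelledV; rewrite invgK.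
Qed.

Lemma spelledS_inv A n g : spelled A n.+1 g ->
  exists x y, [/\ A x \/ A x^-1, spelled A n y & g = x * y].
Proof.
move=> [w [+ + <-]]; case: w => // x w [sw] Aw; exists x, (\prod_(z <- w) z); split.
- by apply: Aw; rewrite inE eqxx.
- by exists w; split => // z zw; apply: Aw; rewrite inE zw orbT.
- by rewrite big_cons.
Qed.

Lemma spelled_ind A (P : nat -> G -> Prop) : P 0%N 1 ->
  (forall n x g, A x \/ A x^-1 -> spelled A n g -> P n g -> P n.+1 (x * g)) ->
  forall n g, spelled A n g -> P n g.
Proof.
move=> P1 PS; elim=> [|n IH] g.
  by move=> [w [/size0nil -> _ <-]]; rewrite big_nil.
by move=> /spelledS_inv[x [y [Ax Ay ->]]]; apply: PS => //; apply: IH.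
Qed.

Lemma generated1 A : generated A 1. Proof. by exists 0%N; apply: spelled1. Qed.

Lemma generatedM A x y : generated A x -> generated A y -> generated A (x * y).
Proof. by move=> [m Ax] [n Ay]; exists (m + n)%N; apply: spelledM. Qed.

Lemma generatedV A x : generated A x -> generated A x^-1.
Proof. by move=> [m Ax]; exists m; apply: spelledV. Qed.

Lemma sub_generated A : A `<=` generated A.
Proof. by move=> x Ax; exists 1%N; apply: spelled_letter. Qed.

Lemma generated_min A (P : set G) : P 1 ->
  (forall x y, P x -> P y -> P (x * y)) -> (forall x, P x -> P x^-1) ->
  A `<=` P -> generated A `<=` P.
Proof.
move=> P1 PM PV AP g [n]; elim/spelled_ind => // {n g} n x g Ax _ Pg.
by apply: PM => //; case: Ax => /AP // /PV; rewrite invgK.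
Qed.

Lemma word_lengthP X g : generated X g -> spelled X (word_length X g) g.
Proof.
move=> [n Xg]; rewrite /word_length; case: xgetP => [k _ [] //|/(_ _) Hn].
have ex : exists k, `[< spelled X k g >] by exists n; apply/asboolP.
case: (ex_minnP ex) => k /asboolP Xk kmin.
by case: (Hn k); split => // m /asboolP/kmin.
Qed.

Lemma word_length_le X n g : spelled X n g -> (word_length X g <= n)%N.
Proof.
move=> Xg; rewrite /word_length; case: xgetP => [k _ [_]|_ //]; exact.
Qed.

Lemma word_length1 X : word_length X 1 = 0%N.
Proof. by apply/eqP; rewrite -leqn0; apply/word_length_le/spelled1. Qed.

Section Generating.
Variable X : set G.
Hypothesis Xgen : finite_generating X.

Lemma spelled_word_length g : spelled X (word_length X g) g.
Proof. by apply: word_lengthP; rewrite Xgen.2. Qed.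

Lemma word_lengthM x y :
  (word_length X (x * y) <= word_length X x + word_length X y)%N.
Proof. by apply/word_length_le/spelledM; apply: spelled_word_length. Qed.

Lemma word_lengthV x : word_length X x^-1 = word_length X x.
Proof.
have le y : (word_length X y^-1 <= word_length X y)%N.
  by apply/word_length_le/spelledV/spelled_word_length.
by apply/eqP; rewrite eqn_leq le -{1}[x]invgK le.
Qed.

Lemma finite_spelled n : finite_set (spelled X n).
Proof.
elim: n => [|n IH].
  apply: (sub_finite_set (B := [set 1])) => // g [w [/size0nil -> _ <-]].
  by rewrite big_nil.
apply: (sub_finite_set (B := [set x * y | x in X `|` [set y^-1 | y in X] & y in spelled X n])).
  move=> _ /spelledS_inv[x [y [Xx Xy ->]]]; exists x; last by exists y.
  by case: Xx => ?; [left|right; exists x^-1; rewrite ?invgK].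
apply: finite_image2 => //; rewrite finite_setU; split; first exact: Xgen.1.
by apply/finite_image/Xgen.1.
Qed.

Lemma finite_ball n : finite_set [set g | (word_length X g <= n)%N].
Proof.
apply: (sub_finite_set (B := \bigcup_(k in `I_n.+1) spelled X k)).
  by move=> g /= gn; exists (word_length X g) => //; apply: spelled_word_length.
by apply: bigcup_finite => // k _; apply: finite_spelled.
Qed.

Lemma finite_relative_ball H n : finite_set [set g | H g /\ (word_length X g <= n)%N].
Proof. by apply: sub_finite_set (finite_ball n) => g []. Qed.

Lemma word_length_bounded Y : finite_set Y ->
  exists m, forall y, Y y -> (word_length X y <= m)%N.
Proof.
move=> Yfin; exists (\max_(y <- fset_set Y) word_length X y) => y Yy.
by apply: leq_bigmax_seq => //; rewrite in_fset_set // inE.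
Qed.

End Generating.

(** Rewriting each letter of [Y] as a word in [X] costs a bounded factor; hence a growth estimate
    for one generating set transfers to all others. *)
Lemma word_length_change X Y : finite_generating X -> finite_generating Y ->
  exists2 c, (0 < c)%N & forall g, (word_length X g <= c * word_length Y g)%N.
Proof.
move=> Xgen Ygen; have [m Ym] := word_length_bounded X Ygen.1.
exists m.+1 => // g; move: (spelled_word_length Ygen g); move: (word_length Y g) => n.
elim/spelled_ind => {n g} [|n x g Yx _ IH]; first by rewrite word_length1.
have lx : (word_length X x <= m)%N by case: Yx => /Ym //; rewrite word_lengthV.
by apply: leq_trans (word_lengthM Xgen _ _) _; lia.
Qed.

Lemma seq_le_relative_growth X H n (s : seq G) : finite_generating X ->
  uniq s -> (forall g, g \in s -> H g /\ (word_length X g <= n)%N) ->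
  (size s <= relative_growth X H n)%N.
Proof.
move=> Xgen us sH; rewrite /relative_growth; apply: uniq_leq_size => // g /sH gH.
by rewrite in_fset_set ?inE //; apply: finite_relative_ball.
Qed.

Lemma relative_growth_le_seq X H n (s : seq G) : finite_generating X ->
  (forall g, H g -> (word_length X g <= n)%N -> g \in s) ->
  (relative_growth X H n <= size s)%N.
Proof.
move=> Xgen sH; apply: uniq_leq_size; first exact: fset_uniq.
move=> g; rewrite in_fset_set ?inE; first by move=> [Hg /(sH _ Hg)].
exact: finite_relative_ball.
Qed.

Lemma leq_relative_growth X Y H m n : finite_generating X -> finite_generating Y ->
  (forall h, H h -> (word_length X h <= m)%N -> (word_length Y h <= n)%N) ->
  (relative_growth X H m <= relative_growth Y H n)%N.
Proof.
move=> Xgen Ygen XY; apply: seq_le_relative_growth => // [|g].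
  exact: fset_uniq.
rewrite in_fset_set ?inE; first by move=> [Hg /(XY _ Hg)].
exact: finite_relative_ball.
Qed.

End WordLength.

(** * The least superadditive majorant *)

Section SuperadditiveHull.
Variable g : nat -> nat.

Definition partition_sums (r : nat) : set nat :=
  [set v | exists s : seq nat,
     [/\ all (ltn 0) s, sumn s = r & \sum_(x <- s) g x = v]].

(** A superadditive function above [g] bounds every partition sum, so their maximum is the least
    such function on positive arguments. The default 0 is taken only when the sums are unbounded. *)
Definition superadditive_hull (r : nat) : nat :=
  xget 0 [set v | partition_sums r v /\ forall u, partition_sums r u -> u <= v].

Variable b : nat -> nat.
Hypothesis bound : forall r v, partition_sums r v -> v <= b r.

Lemma superadditive_hullP r :
  partition_sums r (superadditive_hull r) /\
  forall u, partition_sums r u -> u <= superadditive_hull r.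
Proof.
rewrite /superadditive_hull; case: xgetP => [//|Hn].
have ex : exists v, `[< partition_sums r v >].
  exists (\sum_(x <- nseq r 1) g x); apply/asboolP; exists (nseq r 1).
  by split=> //; [rewrite all_nseq orbT | rewrite sumn_nseq mul1n].
have bd v : `[< partition_sums r v >] -> v <= b r by move=> /asboolP/bound.
case: (ex_maxnP ex bd) => v /asboolP Pv vmax.
by case: (Hn v); split=> // u Pu; apply/vmax/asboolP.
Qed.

Lemma le_superadditive_hull r : 0 < r -> g r <= superadditive_hull r.
Proof.
move=> r0; apply: (superadditive_hullP r).2; exists [:: r].
by split; rewrite /= ?r0 ?addn0 ?big_seq1.
Qed.

Lemma superadditive_hull_le r : superadditive_hull r <= b r.
Proof. exact/bound/(superadditive_hullP r).1. Qed.

(** Optimal partitions of [r] and [s] concatenate to a partition of [r + s]. *)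
Lemma superadditive_hullD : superadditive superadditive_hull.
Proof.
move=> r s _ _; apply: (superadditive_hullP (r + s)).2.
have [[v [v0 vr <-]] _] := superadditive_hullP r.
have [[w [w0 ws <-]] _] := superadditive_hullP s.
by exists (v ++ w); rewrite all_cat v0 w0 sumn_cat vr ws big_cat.
Qed.

End SuperadditiveHull.

(** * Part (1): subgroups that are not locally finite *)

Section NotLocallyFinite.
Variables (G : groupType) (X H : set G).
Hypothesis Xgen : finite_generating X.
Hypothesis Hgroup : group_closed [in H].
Local Open Scope group_scope.

Let H1 : H 1. Proof. by have := Hgroup.1; rewrite inE. Qed.
Let HM x y : H x -> H y -> H (x * y).
Proof. by move=> Hx Hy; have := @group_closedM _ _ Hgroup x y; rewrite !inE; apply. Qed.
Let HV x : H x -> H x^-1.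
Proof. by move=> Hx; have := @group_closedV _ _ Hgroup x; rewrite !inE; apply. Qed.

(* Along a word in elements of [Y] the length in [G] changes by at most [m] at
   each letter, so unboundedness makes it visit every window of width [m]. *)
Lemma element_of_length_about : ~ locally_finite H ->
  exists m, forall n, exists2 h, H h & (n <= word_length X h <= n + m)%N.
Proof.
move=> /existsNP[Y /not_implyP[Yfin /not_implyP[YH Kinf]]].
have [m Ym] := word_length_bounded X Yfin; exists m => n.
have [h [k Yh] hn] : exists2 h, generated Y h & (n <= word_length X h)%N.
  (* Otherwise the infinite subgroup generated by [Y] would lie in a finite ball. *)
  apply: contrapT => Hn; apply: Kinf; apply: sub_finite_set (finite_ball Xgen n).
  move=> h Kh /=; rewrite leqNgt; apply/negP => nh.
  by apply: Hn; exists h => //; apply: ltnW.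
elim/spelled_ind: {k h} Yh hn => [|k y h Yy Yh IH nh].
  by rewrite word_length1 => n0; exists 1; rewrite ?word_length1 ?n0.
have [|hn] := leqP n (word_length X h); first exact: IH.
exists (y * h).
  apply: HM; first by case: Yy => /YH // /HV; rewrite invgK.
  by apply: (generated_min (A := Y)) => //; exists k.
rewrite nh /=; apply: leq_trans (word_lengthM Xgen _ _) _.
have: (word_length X y <= m)%N by case: Yy => /Ym //; rewrite word_lengthV.
by lia.
Qed.

Variable m : nat.
Hypothesis window : forall n, exists2 h, H h & (n <= word_length X h <= n + m)%N.

(* Translates of balls by elements of suitable lengths occupy disjoint annuli. *)
Lemma disjoint_translates (s : seq nat) (n : nat) : all (ltn 0) s ->
  exists2 S : seq G, uniq S /\ size S = \sum_(x <- s) relative_growth X H x &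
    forall g, g \in S ->
      H g /\ (n <= word_length X g < n + m.+3 * sumn s)%N.
Proof.
elim: s n => [|r s IH] n /=; first by exists [::]; rewrite ?big_nil.
(* The [r]-ball translated by [h] has lengths in [[n, n + 2r + m]], and the next annulus starts
   right after. The width [2r + m + 1] is at most [(m + 3) r] because [r] is positive. *)
move=> /andP[r0 s0]; have [h Hh hn] := window (n + r).
have [S [uS sS] SH] := IH (n + r.*2 + m).+1 s0.
pose B := fset_set [set g | H g /\ (word_length X g <= r)%N].
have BP g : g \in B -> H g /\ (word_length X g <= r)%N.
  by rewrite in_fset_set ?inE //; apply: finite_relative_ball.
have TP g : g \in [seq h * g | g <- B] ->
    H g /\ (n <= word_length X g <= n + r.*2 + m)%N.
  move=> /mapP[b /BP[Hb br] ->]; split; first exact: HM.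
  have := word_lengthM Xgen h b; have := word_lengthM Xgen (h * b) b^-1.
  by rewrite mulgK word_lengthV //; lia.
exists ([seq h * g | g <- B] ++ S).
  rewrite cat_uniq uS map_inj_uniq ?fset_uniq /=; last exact: mulgI.
  rewrite size_cat size_map sS big_cons; split=> //; rewrite andbT.
  by apply/hasPn => g /SH[_ gS]; apply/negP => /TP[_]; lia.
move=> g; rewrite mem_cat => /orP[/TP|/SH] [Hg gn]; split => //; nia.
Qed.

Lemma relative_growth_sim_superadditive :
  exists f, [/\ positive_valued f, superadditive f & growth_sim (relative_growth X H) f].
Proof.
set g := relative_growth X H.
have bound r v : partition_sums g r v -> (v <= g (m.+3 * r))%N.
  move=> [s [s0 <- <-]]; have [S [uS <-] SH] := disjoint_translates 0 s0.
  by apply: seq_le_relative_growth => // x /SH[Hx]; split=> //; lia.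
have mono i j : (i <= j)%N -> (g i <= g j)%N.
  by move=> ij; apply: leq_relative_growth => // h _; lia.
exists (superadditive_hull g); split.
- move=> r r0; apply: leq_trans (le_superadditive_hull bound r0).
  apply: (@seq_le_relative_growth _ _ _ _ [:: 1]) => // x.
  by rewrite inE => /eqP ->; rewrite word_length1.
- exact: superadditive_hullD bound.
- exists m.+3 => // r r0; split; last exact: (superadditive_hull_le bound).
  apply: leq_trans (le_superadditive_hull bound _); last by lia.
  by apply: mono; nia.
Qed.

End NotLocallyFinite.

(** * Wreath products *)

Definition additive_group (V : zmodType) : Type := V.

HB.instance Definition _ (V : zmodType) := Choice.on (additive_group V).
HB.instance Definition _ (V : zmodType) :=
  isGroup.Build (additive_group V) (@GRing.addrA V) (@GRing.add0r V)
    (@GRing.addr0 V) (@GRing.addNr V) (@GRing.addrN V).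

Lemma additive_mulE (V : zmodType) (x y : additive_group V) : (x * y)%g = (x + y)%R.
Proof. by []. Qed.

(* The unrestricted wreath product; [B] acts on functions by right translation
   of the argument, so that reading a word from left to right moves a cursor in
   [B] by right multiplication. *)
Record wreath (K B : Type) := Wreath { base : B -> K; top : B }.

HB.instance Definition _ (K B : Type) := gen_eqMixin (wreath K B).
HB.instance Definition _ (K B : Type) := gen_choiceMixin (wreath K B).

Section WreathGroup.
Variables K B : groupType.
Local Open Scope group_scope.
Implicit Types g h : wreath K B.

Definition wreath_mul g h :=
  Wreath (fun x => base g x * base h (x * top g)) (top g * top h).
Definition wreath_one : wreath K B := Wreath (fun=> 1) 1.
Definition wreath_inv g :=
  Wreath (fun x => (base g (x * (top g)^-1))^-1) (top g)^-1.

Lemma wreath_eq g h : base g =1 base h -> top g = top h -> g = h.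
Proof. by case: g h => [F b] [F' b'] /= /funext -> ->. Qed.

Lemma wreath_mulA : associative wreath_mul.
Proof. by move=> g h k; apply: wreath_eq => [x|] /=; rewrite !mulgA. Qed.

Lemma wreath_mul1g : left_id wreath_one wreath_mul.
Proof. by move=> g; apply: wreath_eq => [x|] /=; rewrite ?mulg1 mul1g. Qed.

Lemma wreath_mulg1 : right_id wreath_one wreath_mul.
Proof. by move=> g; apply: wreath_eq => [x|] /=; rewrite mulg1. Qed.

Lemma wreath_mulVg : left_inverse wreath_one wreath_inv wreath_mul.
Proof. by move=> g; apply: wreath_eq => [x|] /=; rewrite mulVg. Qed.

Lemma wreath_mulgV : right_inverse wreath_one wreath_inv wreath_mul.
Proof. by move=> g; apply: wreath_eq => [x|] /=; rewrite ?mulgK mulgV. Qed.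

HB.instance Definition _ := isGroup.Build (wreath K B)
  wreath_mulA wreath_mul1g wreath_mulg1 wreath_mulVg wreath_mulgV.

Lemma base_mul g h x : base (g * h) x = base g x * base h (x * top g).
Proof. by []. Qed.
Lemma top_mul g h : top (g * h) = top g * top h. Proof. by []. Qed.
Lemma base_one x : base (1 : wreath K B) x = 1. Proof. by []. Qed.
Lemma top_one : top (1 : wreath K B) = 1. Proof. by []. Qed.
Lemma base_inv g x : base g^-1 x = (base g (x * (top g)^-1))^-1.
Proof. by []. Qed.
Lemma top_inv g : top g^-1 = (top g)^-1. Proof. by []. Qed.
Definition wreathE := (base_mul, top_mul, base_one, top_one, base_inv, top_inv).

End WreathGroup.

(** * The subgroup generated by a set, as a group in its own right *)

Section GeneratedGroup.
Variables (W : groupType) (A : set W).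
Local Open Scope group_scope.

Definition in_generated : pred W := fun x => `[< generated A x >].

Definition generated_group : Type := {x : W | in_generated x}.

HB.instance Definition _ := SubChoice.on generated_group.

Lemma in_generated_closed : group_closed in_generated.
Proof.
split; first by apply/asboolP/generated1.
move=> x y /asboolP Ax /asboolP Ay; apply/asboolP.
by apply: generatedM => //; apply: generatedV.
Qed.

HB.instance Definition _ :=
  SubChoice_isSubGroup.Build W in_generated generated_group in_generated_closed.

Definition generators : set generated_group := [set g | A (val g)].

Lemma spelled_generators n (g : generated_group) :
  spelled generators n g <-> spelled A n (val g).
Proof.
split; first (move: n g; apply: spelled_ind => [|n x g Ax _ IH]).
- exact: spelled1.
- by rewrite gmulfM; apply: spelledS.
(* Quantifying over all lifts [h] of [x] lets the induction run over words of the ambient group. *)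
suff Q k (x : W) : spelled A k x ->
    forall h : generated_group, val h = x -> spelled generators k h.
  by move=> Ag; apply: Q Ag g erefl.
move: k x; apply: spelled_ind => [|k x y Ax Ay IH] h.
  by move=> h1; have -> : h = 1; [apply: val_inj; rewrite h1 gmulf1 | apply: spelled1].
have Gx : in_generated x.
  apply/asboolP; case: Ax => /sub_generated // /generatedV; by rewrite invgK.
have Gy : in_generated y by apply/asboolP; exists k.
pose x' : generated_group := Sub x Gx; pose y' : generated_group := Sub y Gy.
move=> hE; have -> : h = x' * y' by apply: val_inj; rewrite hE gmulfM.
apply: spelledS; last exact: IH.
by case: Ax => ?; [left | right; rewrite /generators /mkset gmulfV].
Qed.

Lemma generators_finite_generating : finite_set A -> finite_generating generators.
Proof.
move=> Afin; split.
  by apply: finite_preimage Afin => x y _ _; apply: val_inj.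
apply/seteqP; split=> // g _; have /asboolP[n Ag] := valP g.
by exists n; apply/spelled_generators.
Qed.

Lemma word_length_generators (g : generated_group) :
  spelled A (word_length generators g) (val g).
Proof.
apply/spelled_generators/word_lengthP.
by have /asboolP[n Ag] := valP g; exists n; apply/spelled_generators.
Qed.

End GeneratedGroup.

(** * Solvability of subgroups and of wreath products *)

Section Solvable.
Local Open Scope group_scope.

Lemma derived1 (G : groupType) n : derived n (1 : G).
Proof. by case: n => [//|n]; apply: generated1. Qed.

Lemma derived_le (G : groupType) n (P : set G) : P 1 ->
  (forall x y, P x -> P y -> P (x * y)) -> (forall x, P x -> P x^-1) ->
  (forall x y, derived n x -> derived n y -> P [~ x, y]) -> derived n.+1 `<=` P.
Proof.
by move=> P1 PM PV PC; apply: generated_min => // _ [x [y [Dx Dy ->]]]; apply: PC.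
Qed.

Lemma derived_comm (G : groupType) n (x y : G) :
  derived n x -> derived n y -> derived n.+1 [~ x, y].
Proof. by move=> Dx Dy; apply: sub_generated; exists x, y. Qed.

Lemma derivedM (G : groupType) n (x y : G) :
  derived n x -> derived n y -> derived n (x * y).
Proof. by case: n => [//|n]; apply: generatedM. Qed.

Lemma derivedV (G : groupType) n (x : G) : derived n x -> derived n x^-1.
Proof. by case: n => [//|n]; apply: generatedV. Qed.

Lemma solvable_groupP (G : groupType) :
  solvable_group G <-> exists n, forall x : G, derived n x -> x = 1.
Proof.
split=> [[n Dn]|[n D1]]; exists n; first by move=> x; rewrite Dn.
by apply/seteqP; split=> [x /D1|_ ->] //; apply: derived1.
Qed.

Lemma solvable_injective (G H : groupType) (f : UMagmaMorphism.type G H) :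
  injective f -> solvable_group H -> solvable_group G.
Proof.
move=> finj /solvable_groupP[n Dn]; apply/solvable_groupP; exists n => x Dx.
apply: finj; rewrite gmulf1; apply: Dn.
elim: n x Dx => [//|n IH].
apply: (@derived_le G n [set x | derived n.+1 (f x)]); rewrite /mkset.
- by rewrite gmulf1; apply: derived1.
- by move=> x y; rewrite gmulfM; apply: derivedM.
- by move=> x; rewrite gmulfV; apply: derivedV.
- by move=> x y /IH Dx /IH Dy; rewrite gmulfR; apply: derived_comm.
Qed.

Lemma solvable_commutative (G : groupType) :
  commutative (@mul G) -> solvable_group G.
Proof.
move=> GC; apply/solvable_groupP; exists 1%N.
apply: derived_le => [//|x y -> ->|x ->|x y _ _]; rewrite ?mulg1 ?invg1 //.
by apply/eqP/commgP; apply: GC.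
Qed.

Lemma derived_wreath_top (K B : groupType) n (g : wreath K B) :
  derived n g -> derived n (top g).
Proof.
elim: n g => [//|n IH].
apply: (@derived_le _ n [set g | derived n.+1 (top g)]); rewrite /mkset.
- exact: derived1.
- by move=> x y; apply: derivedM.
- by move=> x; apply: derivedV.
- by move=> x y /IH Dx /IH Dy; apply: derived_comm.
Qed.

(** After [n] derived steps the top component is trivial; from then on products are pointwise, and
    [m] further steps kill every coordinate. *)
Lemma solvable_wreath (K B : groupType) :
  solvable_group K -> solvable_group B -> solvable_group (wreath K B).
Proof.
move=> /solvable_groupP[m Dm] /solvable_groupP[n Dn]; apply/solvable_groupP.
exists (m + n)%N => g Dg.
have {Dg} [DF Dt] : (forall x, derived m (base g x)) /\ top g = 1.
  elim: {Dm} m g Dg => [|m IH] g.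
    by move=> /derived_wreath_top/Dn ->.
  move: g; apply: derived_le =>
    [|g h [Fg tg] [Fh th]|g [Fg tg]|g h /IH[Fg tg] /IH[Fh th]].
  - by split=> // x; apply: derived1.
  - by rewrite !wreathE tg th mulg1; split=> // x; apply: derivedM.
  - by rewrite !wreathE tg invg1; split=> // x; apply: derivedV.
  - rewrite /commg /conjg !wreathE tg th !(invg1, mulg1); split=> // x.
    by rewrite !wreathE ?(tg, th, invg1, mulg1); apply: derived_comm.
by apply: wreath_eq => [x|] //=; apply: Dm.
Qed.

End Solvable.

(** * The lamplighter group and distances in it *)

Section Lamplighter.
Import GRing.Theory.
Local Open Scope group_scope.

Definition lamplighter := wreath (additive_group bool) (additive_group int).

HB.instance Definition _ := Group.on lamplighter.

Implicit Types (x y w : lamplighter) (k : int).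

Definition lamp x k : bool := base x k.
Definition shift x : int := top x.

Lemma lampM x y k : lamp (x * y) k = lamp x k (+) lamp y (k + shift x)%R.
Proof. by []. Qed.
Lemma shiftM x y : shift (x * y) = (shift x + shift y)%R.
Proof. by []. Qed.
Lemma shift1 : shift 1 = 0%R. Proof. by []. Qed.
Lemma lampV x k : lamp x^-1 k = lamp x (k - shift x)%R.
Proof. by []. Qed.
Lemma shiftV x : shift x^-1 = (- shift x)%R.
Proof. by []. Qed.

Lemma lamplighter_eq x y : lamp x =1 lamp y -> shift x = shift y -> x = y.
Proof. by move=> xy txy; apply: (@wreath_eq (additive_group bool) (additive_group int)). Qed.

Definition move_gen : lamplighter := Wreath (fun=> false) (1%R : int).
(* [x * lamp_gen] differs from [x] at the lamp [- shift x]. *)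
Definition lamp_gen : lamplighter := Wreath (fun k : int => k == 0%R) (0%R : int).
Definition lamplighter_gens : set lamplighter := [set move_gen; lamp_gen].

Lemma solvable_lamplighter : solvable_group lamplighter.
Proof.
by apply: solvable_wreath; apply: solvable_commutative; apply: addrC.
Qed.

Definition lamps (A : nat -> bool) : lamplighter :=
  Wreath (fun k : int => if k is Posz n then A n else false) (0%R : int).

Lemma lamplighter_letter (s : lamplighter) :
  lamplighter_gens s \/ lamplighter_gens s^-1 ->
  `|shift s|%N <= 1 /\ forall k, lamp s k -> k = 0%R.
Proof.
suff P x : lamplighter_gens x -> [/\ `|shift x|%N <= 1,
    (forall k, lamp x k -> k = 0%R) & forall k, lamp x^-1 k -> k = 0%R].
  case=> /P[tx bx bVx]; split=> //.
    by move: tx; rewrite shiftV abszN.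
  by move: bVx; rewrite invgK.
by case=> ->; split=> // k; rewrite ?lampV /lamp /shift /= ?subr0 // => /eqP.
Qed.

Lemma lamplighter_spelled_bound n w : spelled lamplighter_gens n w ->
  `|shift w|%N <= n /\ forall k, lamp w k -> `|k|%N <= n.
Proof.
move: n w; apply: spelled_ind => [|n s w /lamplighter_letter[st sb] _ [IHt IHb]].
  by [].
split; first by rewrite shiftM; lia.
move=> k; rewrite lampM; case sk : (lamp s k); first by rewrite (sb _ sk).
by move=> /IHb; lia.
Qed.

(** The lamps lit in [w] are those where the two configurations differ, and a word of length [n]
    reaches no lamp beyond [n]. *)
Lemma lamps_distance (A A' : nat -> bool) n w (k : nat) :
  spelled lamplighter_gens n w -> lamps A * w = lamps A' -> A k != A' k -> k <= n.
Proof.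
move=> /lamplighter_spelled_bound[_ wb] /(congr1 (fun x => lamp x (k%:Z)%R)).
rewrite lampM /shift /= addr0 /lamp /= => <- kA; apply: (wb (k%:Z)%R).
by move: kA; rewrite /lamp; case: (A k); case: (base w _).
Qed.

Lemma spelled_lamps (A : nat -> bool) N : (forall i, N <= i -> A i = false) ->
  exists2 n, n <= 3 * N & spelled lamplighter_gens n (lamps A).
Proof.
move=> AN.
(* The state after setting the lamps below [M]: the shift is [-M] because [lamp_gen] acts at minus
   the shift. Each lamp costs at most one toggle and one move, and [N] moves lead back, whence
   [3 * N]. *)
pose part M : lamplighter :=
  Wreath (fun k : int => if k is Posz i then (i < M) && A i else false) (- M%:Z)%R.
have tV : spelled lamplighter_gens 1 move_gen^-1.
  by apply/spelledV/spelled_letter; left.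
have [n nN Sn] : exists2 n, n <= 2 * N & spelled lamplighter_gens n (part N).
  elim: N {AN} => [|M [n nM Sn]].
    exists 0 => //; suff -> : part 0 = 1 by apply: spelled1.
    by apply: lamplighter_eq => // -[].
  pose toggle : lamplighter := if A M then lamp_gen else 1.
  have [m m1 Sm] : exists2 m, m <= 1 & spelled lamplighter_gens m toggle.
    rewrite /toggle; case: (A M); last by exists 0; last exact: spelled1.
    by exists 1%N; last by apply: spelled_letter; right.
  exists (n + m + 1)%N; first by lia.
  suff -> : part M.+1 = part M * toggle * move_gen^-1.
    by apply: spelledM => //; apply: spelledM.
  apply: lamplighter_eq => [k|].
    rewrite !lampM lampV addbF /lamp /shift /=.
    rewrite /toggle; case AM : (A M) => /=; case: k => [i|i] //=; last first.
    - by rewrite addbF ltnS leq_eqVlt; case: eqP => [->|//]; rewrite AM ltnn.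
    - by lia.
    - have -> : (i%:Z - M%:Z == 0)%R = (i == M) by lia.
      by rewrite ltnS leq_eqVlt; case: eqP => [->|_]; rewrite ?AM ?ltnn ?addbF.
  by rewrite !shiftM shiftV /toggle; case: (A M); rewrite ?shift1 /shift /=; lia.
exists (n + N); first by lia.
have -> : lamps A = part N * move_gen ^+ N.
  have mN : shift (move_gen ^+ N) = N%:Z%R /\ forall k, lamp (move_gen ^+ N) k = false.
    elim: (N) => [//|M [IHs IHl]]; rewrite expgS shiftM IHs; split.
      by rewrite /shift /=; lia.
    by move=> k; rewrite lampM IHl.
  apply: lamplighter_eq => [k|].
    rewrite lampM mN.2 addbF /lamp /=; case: k => // i.
    by case: ltnP => // /AN.
  by rewrite shiftM mN.1 /shift /= addNr.
apply: spelledM => //; elim: (N) => [|M IH]; first exact: spelled1.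
by rewrite expgS; apply: spelledS => //; left; left.
Qed.

End Lamplighter.

(** * The host group: letters placed at distant points of the lamplighter group *)

Section Construction.
Local Open Scope group_scope.
Variables (I : Type) (L : I -> nat) (c : I -> nat -> bool).
Hypothesis code_inj : forall i j, L i = L j ->
  (forall k, (k < L i)%N -> c i k = c j k) -> i = j.

(* The lamp [2 * L i] records [L i], the lamps below it record the code of [i];
   all of them lie at distance at least [L i], so that distinct positions are
   far apart. *)
Definition position_lamps (i : I) (k : nat) : bool :=
  (k == (L i).*2) || (L i <= k < (L i).*2)%N && c i (k - L i).

Definition position (i : I) : lamplighter := lamps (position_lamps i).

Lemma position_differ_lt i j : (L i < L j)%N ->
  position_lamps i (L j).*2 != position_lamps j (L j).*2.
Proof. by move=> ij; rewrite /position_lamps eqxx /=; lia. Qed.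

(** For different values of [L] the marker lamp of the larger one distinguishes the positions; for
    equal values some code lamp does. *)
Lemma position_differ i j : i <> j ->
  exists2 k, (L i <= k)%N && (L j <= k)%N & position_lamps i k != position_lamps j k.
Proof.
move=> ij; case: (ltngtP (L i) (L j)) => Lij.
- by exists (L j).*2; [lia | apply: position_differ_lt].
- by exists (L i).*2; [lia | rewrite eq_sym; apply: position_differ_lt].
- apply: contrapT => Hn; apply/ij/code_inj => // k kL.
  apply: contrapT => ck; apply: Hn; exists (L i + k)%N; first by lia.
  rewrite /position_lamps -Lij addKn.
  have -> : (L i + k == (L i).*2)%N = false by lia.
  have -> : (L i <= L i + k < (L i).*2)%N by lia.
  exact/eqP.
Qed.

Lemma position_distance i j n w : spelled lamplighter_gens n w ->
  position i * w = position j -> i <> j -> (L i <= n)%N && (L j <= n)%N.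
Proof.
move=> Sw E /position_differ[k ijk dk].
by have := lamps_distance Sw E dk; lia.
Qed.

Lemma position_distance1 i n : spelled lamplighter_gens n (position i) -> (L i <= n)%N.
Proof.
move=> Sw; have := @lamps_distance (fun=> false) (position_lamps i) n _ (L i).*2 Sw.
rewrite /position_lamps eqxx; have -> : lamps (fun=> false) = 1.
  by apply: lamplighter_eq => // -[].
by rewrite mul1g => /(_ erefl erefl); lia.
Qed.

Lemma position_inj : injective position.
Proof.
move=> i j E; apply: contrapT => /position_differ[k _ /eqP]; apply.
exact: (congr1 (fun x => lamp x (Posz k)) E).
Qed.

Variables (K : groupType) (v : I -> K) (u : K).

(** Which preimage [cid] picks is immaterial, since [position] is injective. *)
Definition beacons (x : lamplighter) : K :=
  if pselect (exists i, position i = x) is left e then v (projT1 (cid e)) else 1.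

Lemma beacons_position i : beacons (position i) = v i.
Proof.
rewrite /beacons; case: pselect => [e|[]]; last by exists i.
by congr v; apply: position_inj; case: cid.
Qed.

Lemma beaconsP x : beacons x = 1 \/ exists2 i, x = position i & beacons x = v i.
Proof.
have [[i <-]|Hn] := pselect (exists i, position i = x).
  by right; exists i => //; apply: beacons_position.
by left; rewrite /beacons; case: pselect.
Qed.

Let W := wreath K lamplighter.

Definition at_origin (k : K) : W := Wreath (fun x => if x == 1 then k else 1) 1.
Definition walk (x : lamplighter) : W := Wreath (fun=> 1) x.
Definition beacon_gen : W := Wreath beacons 1.

Definition host_gens : set W :=
  [set g | [\/ exists2 x, lamplighter_gens x & g = walk x, g = beacon_gen |
               g = at_origin u]].

Lemma finite_host_gens : finite_set host_gens.
Proof.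
apply: (sub_finite_set
  (B := [set walk x | x in lamplighter_gens] `|` [set beacon_gen; at_origin u])).
  by move=> g [[x]||]; [left; exists x | right; left | right; right].
rewrite finite_setU; split; last exact: finite_set2.
exact/finite_image/finite_set2.
Qed.

Lemma base_at_origin k x : base (at_origin k) x = if x == 1 then k else 1.
Proof. by []. Qed.

Lemma at_originM k l : at_origin (k * l) = at_origin k * at_origin l.
Proof.
apply: wreath_eq => [x|] /=; last by rewrite mulg1.
by rewrite mulg1; case: ifP => // _; rewrite mulg1.
Qed.

Lemma at_origin_inj : injective at_origin.
Proof. by move=> k l /(congr1 (fun g => base g 1)); rewrite /= eqxx. Qed.

Lemma walkM x y : walk (x * y) = walk x * walk y.
Proof. by apply: wreath_eq => [z|] //=; rewrite mulg1. Qed.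

Lemma walkV x : walk x^-1 = (walk x)^-1.
Proof. by apply: wreath_eq => [z|] //=; rewrite invg1. Qed.

Lemma spelled_walk n x : spelled lamplighter_gens n x -> spelled host_gens n (walk x).
Proof.
move: n x; apply: spelled_ind => [|n s x Ss _ IH]; first exact: spelled1.
rewrite walkM; apply: spelledS => //; rewrite -walkV.
by case: Ss; [left|right]; constructor 1; [exists s|exists s^-1].
Qed.

(* The commutator of [beacon_gen], moved so that [position i] lies over the
   origin, with [at_origin u] is supported at the origin only. *)
Lemma spelled_at_origin i : exists2 n, (n <= 24 * L i + 16)%N &
  spelled host_gens n (at_origin (v i * u * (v i)^-1 * u^-1)).
Proof.
have [|n nL Sn] := @spelled_lamps (position_lamps i) (L i).*2.+1.
  by move=> k kL; rewrite /position_lamps; lia.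
(* A commutator of a conjugate of length [2n + 1] with a letter has length [4n + 4], and
   [n <= 3 * (2 * L i + 1)]. *)
exists (((n + 1 + n) + 1 + (n + 1 + n)) + 1)%N; first by lia.
set p := position i; set g := walk p * beacon_gen * (walk p)^-1.
have Sp : spelled host_gens n (walk p) by apply: spelled_walk.
have Sg : spelled host_gens (n + 1 + n) g.
  apply: spelledM; last exact: spelledV.
  by apply: spelledM => //; apply: spelled_letter; constructor 2.
have Su : spelled host_gens 1 (at_origin u).
  by apply: spelled_letter; constructor 3.
suff -> : at_origin (v i * u * (v i)^-1 * u^-1) =
    g * at_origin u * g^-1 * (at_origin u)^-1.
  by do ?apply: spelledM => //; apply: spelledV.
apply: wreath_eq => [x|]; rewrite /g !wreathE /= !(mul1g, mulg1, invg1, mulgV) //.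
case: eqP => [->|_]; rewrite ?(mul1g, mulg1, invg1, mulgV) //.
by rewrite beacons_position.
Qed.

Lemma host_letter (s : W) : host_gens s \/ host_gens s^-1 ->
  (exists2 x, spelled lamplighter_gens 1 x & s = walk x) \/
  top s = 1 /\
  ((base s = beacons \/ base s = fun x => (beacons x)^-1) \/
   (base s = base (at_origin u) \/ base s = base (at_origin u^-1))).
Proof.
case=> [[[x Sx ->]|->|->]|].
- by left; exists x => //; apply: spelled_letter.
- by right; split=> //; left; left.
- by right; split=> //; right; left.
move=> E; have -> : s = s^-1^-1 by rewrite invgK.
case: E => [[x Sx ->]|->|->].
- by left; exists x^-1; [apply/spelledV/spelled_letter | rewrite walkV].
- right; split; first by rewrite top_inv invg1.
  by left; right; apply/funext => x; rewrite base_inv invg1 mulg1.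
- right; split; first by rewrite top_inv invg1.
  right; right; apply/funext => x; rewrite base_inv /= invg1 mulg1.
  by case: ifP; rewrite ?invg1.
Qed.

(* [base (s * g) x = base s x * base g (x * top s)]: reading a word from the
   left, the cursor [x] moves and values met on the way are multiplied. *)
Lemma base_spelled_mem (P : set K) r : P 1 ->
  (forall k l, P k -> P l -> P (k * l)) -> (forall k, P k -> P k^-1) ->
  P u -> (forall i, (L i <= r)%N -> P (v i)) ->
  forall n g, spelled host_gens n g -> (n <= r)%N -> P (base g 1).
Proof.
move=> P1 PM PV Pu Pv.
(* The cursor is allowed to start at any [x] of length [m], with [m] charged against the budget [r];
   a beacon met at [x] then has [L i <= m]. *)
suff Q n g : spelled host_gens n g ->
    forall m x, spelled lamplighter_gens m x -> (m + n <= r)%N -> P (base g x).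
  by move=> n g Sg nr; apply: (Q n g Sg 0%N) => //; apply: spelled1.
move: n g; apply: spelled_ind => [|n s g Ss _ IH] m x Sx mr //.
have Pb y : spelled lamplighter_gens m y -> P (beacons y).
  case: (beaconsP y) => [-> //|[i -> ->]] /position_distance1 Li.
  by apply: Pv; lia.
have Po k : P k -> P (base (at_origin k) x) by move=> Pk /=; case: ifP.
rewrite base_mul; case: (host_letter Ss) => [[y Sy ->]|[-> Bs]].
  by rewrite mul1g; apply: (IH (m + 1)%N); [apply: spelledM|lia].
rewrite mulg1; apply: PM; last by apply: (IH m) => //; lia.
by case: Bs => [[]|[]] ->; auto.
Qed.

Section Involutions.
Variables (lam : K -> nat) (C : nat).
Hypotheses (lam1 : lam 1 = 0%N) (lamM : forall k l, (lam (k * l) <= lam k + lam l)%N).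
Hypotheses (lamu : lam u = 0%N) (uu : u * u = 1).
Hypotheses (lamv : forall i, (lam (v i) <= C * L i)%N) (vv : forall i, v i * v i = 1).

(* A factor [v i] still pending after the cursor has left [position i] is paid
   for by the [m] letters walked since; distinct positions being at distance at
   least [L i], the payment covers [lam (v i)] before another beacon is met. *)
Lemma base_spelled_lam n g : spelled host_gens n g ->
  (lam (base g 1%g) <= C * n)%N.
Proof.
have uV : u^-1 = u by apply/mulg1_eq.
have vV i : (v i)^-1 = v i by apply/mulg1_eq.
have flush i k : (lam k <= C * L i + lam (v i * k))%N.
  by have := lamM (v i) (v i * k); have := lamv i; rewrite mulgA vv mul1g; lia.
(* Letters are prepended, so [g] is read from the cursor [x]; the second alternative records an
   unpaid beacon [m] steps away. At the end [x = 1], and the distance from the origin to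
   [position i] pays for it. *)
suff Q : forall n g, spelled host_gens n g -> forall x,
    (lam (base g x) <= C * n)%N \/
    exists i m y, [/\ spelled lamplighter_gens m y, x * y = position i &
      (lam (v i * base g x) + C * m <= C * n)%N].
  move=> /Q/(_ 1%g)[//|[i [m [y [Sy]]]]]; rewrite mul1g => yE.
  by rewrite {}yE in Sy; have := flush i (base g 1); have := position_distance1 Sy; nia.
move=> {g} {}n g; move: n g; apply: spelled_ind => [|n s g Ss _ IH] x.
  by left; rewrite lam1.
rewrite base_mul; case: (host_letter Ss) => [[z Sz ->]|[-> Bs]].
  have -> : base (walk z) x * base g (x * top (walk z)) = base g (x * z).
    exact: mul1g.
  case: (IH (x * z)) => [|[i [m [y [Sy xy le]]]]]; first by left; lia.
  right; exists i, m.+1, (z * y); split; rewrite ?mulgA //; last by lia.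
  by rewrite -add1n; apply: spelledM.
have {Bs} Bs : base s x = beacons x \/ base s x = base (at_origin u) x.
  rewrite uV in Bs; case: Bs => [[]|[]] ->; [left|left|right|right] => //.
  by case: (beaconsP x) => [->|[i _ ->]]; rewrite ?invg1 ?vV.
rewrite mulg1; case: Bs => ->.
  case: (beaconsP x) => [->|[i xi ->]].
    rewrite mul1g; case: (IH x) => [|[j [m [y [Sy xy le]]]]]; first by left; lia.
    by right; exists j, m, y; split=> //; lia.
  have pending : (lam (base g x) <= C * n)%N -> exists i0 m y,
      [/\ spelled lamplighter_gens m y, x * y = position i0
        & (lam (v i0 * (v i * base g x)) + C * m <= C * n.+1)%N].
    move=> le; exists i, 0%N, 1%g; split; first exact: spelled1.
      by rewrite mulg1.
    by rewrite mulgA vv mul1g; lia.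
  case: (IH x) => [/pending|[j [m [y [Sy xy le]]]]]; first by right.
  (* If the pending beacon is the one at [x], the new factor settles it at no cost. Otherwise
     [m >= L j] pays for [j], and [i] becomes the pending beacon. *)
  have [ji|ij] := pselect (j = i); first by left; rewrite ji in le; lia.
  right; apply: pending; have := flush j (base g x).
  have yE : position i * y = position j by rewrite -xi.
  by have /andP[_] := position_distance Sy yE (nesym ij); nia.
rewrite base_at_origin; case: eqP => [x1|_]; last first.
  rewrite mul1g; case: (IH x) => [|[j [m [y [Sy xy le]]]]]; first by left; lia.
  by right; exists j, m, y; split=> //; lia.
left; have := lamM u (base g x); rewrite lamu.
case: (IH x) => [|[j [m [y [Sy]]]]]; first by lia.
rewrite {1}x1 mul1g => yE; rewrite {}yE in Sy; have := flush j (base g x).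
by have := position_distance1 Sy; nia.
Qed.

End Involutions.

Definition host : groupType := generated_group host_gens.

(** Each value of [iota] is a commutator of some [v i] with [u], so its copy at the origin lies in
    the host group. *)
Lemma host_embedding (H : groupType) (iota : H -> K) :
  {morph iota : x y / x * y} -> injective iota ->
  (forall h, exists i, iota h = v i * u * (v i)^-1 * u^-1) ->
  exists phi : {multiplicative H -> host},
    injective phi /\ forall h, val (phi h) = at_origin (iota h).
Proof.
move=> iotaM iota_inj iotaE.
have Gi h : in_generated host_gens (at_origin (iota h)).
  have [i ->] := iotaE h; apply/asboolP; have [n _ Sn] := spelled_at_origin i.
  by exists n.
pose f h : host := Sub (at_origin (iota h)) (Gi h).
have fM : {morph f : x y / x * y}.
  by move=> x y; apply: val_inj; rewrite gmulfM /= iotaM at_originM.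
pose phi : {multiplicative H -> host} := HB.pack f (isMultiplicative.Build _ _ f fM).
exists phi; split=> // x y /(congr1 val) /= /at_origin_inj; exact: iota_inj.
Qed.

End Construction.

(** * Monotonicity and linear lower bound of superadditive functions *)

Section Superadditive.
Variable f : nat -> nat.
Hypothesis fD : superadditive f.

Lemma superadditive_mono r s : 0 < r -> r <= s -> f r <= f s.
Proof.
move=> r0; rewrite leq_eqVlt => /orP[/eqP -> //|rs].
have := @fD r (s - r) r0; rewrite subn_gt0 rs => /(_ isT).
by rewrite subnKC; [lia | exact: ltnW].
Qed.

Lemma superadditive_linear r q : 0 < r -> 0 < f r -> 0 < q -> q <= f (r * q).
Proof.
move=> r0 fr; elim: q => // -[_ _|q IH _]; first by rewrite muln1.
have := fD (r := r) (s := r * q.+1) r0; rewrite muln_gt0 r0 -mulnS => /(_ isT).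
by have := IH isT; lia.
Qed.

End Superadditive.

(** * Part (2): locally finite groups *)

Section LocallyFinite.
Variable H : groupType.
Hypotheses (Hcount : countable [set: H]) (Hlf : locally_finite [set: H]).
Local Open Scope group_scope.

Let K := wreath H (additive_group int).

Definition half_line (h : H) : K :=
  Wreath (fun k : int => if (0 <= k)%R then h else 1) (0%R : int).
Definition translation : K := Wreath (fun=> 1) (1%R : int).
Definition at_minus_one (h : H) : K :=
  Wreath (fun k : int => if k == (-1)%R then h else 1) (0%R : int).

Lemma at_minus_oneM : {morph at_minus_one : x y / x * y}.
Proof.
move=> x y; apply: wreath_eq => [k|] //=.
by rewrite additive_mulE GRing.addr0; case: ifP; rewrite ?mulg1.
Qed.

Lemma at_minus_one_inj : injective at_minus_one.
Proof. by move=> x y /(congr1 (fun g => base g (-1 : int)%R)). Qed.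

(** A half-line and its translate by one differ only at the point [-1]. *)
Lemma at_minus_oneE h :
  at_minus_one h = half_line h^-1 * translation * (half_line h^-1)^-1 * translation^-1.
Proof.
apply: wreath_eq => [k|] //.
change ((if k == (-1 : int)%R then h else 1) =
  (if (0 <= (k : int))%R then h^-1 else 1) * 1 /
  (if (0 <= (k : int) + (0 + 1) - 0)%R then h^-1 else 1) / 1).
rewrite GRing.add0r GRing.subr0.
rewrite !invg1 !mulg1; case: (k : int) => [n|[|n]] /=.
- by rewrite invgK mulVg.
- by rewrite invgK mul1g.
- by rewrite invg1 mulg1.
Qed.

Lemma locally_finite_exhaustion : exists (idx : H -> nat) (F : nat -> set H),
  [/\ injective idx, forall k, finite_set (F k),
    forall k, [/\ F k 1, forall x y, F k x -> F k y -> F k (x * y) &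
               forall x, F k x -> F k x^-1] &
    forall h k, (idx h <= k)%N -> F k h].
Proof.
have [idx /in2TT idx_inj] := countable_injP _ Hcount.
exists idx, (fun k => generated [set h | (idx h <= k)%N]); split=> //.
- move=> k; apply: Hlf => //.
  apply: (sub_finite_set (B := idx @^-1` `I_k.+1)) => //.
  by apply: finite_preimage => // x y _ _; apply: idx_inj.
- move=> k; split; [exact: generated1|exact: generatedM|exact: generatedV].
- by move=> h k hk; apply: sub_generated.
Qed.

Lemma locally_finite_embedding :
  exists (G : groupType) (phi : {multiplicative H -> G}),
    [/\ finitely_generated G, injective phi &
      forall X : set G, finite_generating X ->
      forall f, superadditive f -> nonzero_fun f ->
        ~ growth_approx (relative_growth X (range phi)) f].
Proof.
have [idx [F [idx_inj Ffin Fgrp idxF]]] := locally_finite_exhaustion.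
pose N k := size (fset_set (F k)).
(* The gap after [level k] is long enough that a function growing linearly exceeds any chosen
   multiple of [N k] within it, once [k] is large. *)
pose level := fix level k := if k is j.+1 then (level j + j * (j * N j + 1) + 1)%N else 0%N.
have levelS k : (level k + k * (k * N k + 1) < level k.+1)%N by rewrite [level k.+1]/=; lia.
have level_lt j k : (j < k)%N -> (level j < level k)%N.
  elim: k => // k IH; rewrite ltnS leq_eqVlt => /orP[/eqP->|/IH jk];
    by have := levelS k; lia.
have level_le j k : (j <= k)%N -> (level j <= level k)%N.
  by rewrite leq_eqVlt => /orP[/eqP->|/level_lt] //; lia.
(* Here [L] is injective, so a constant code suffices. *)
pose L h := level (idx h); pose c (h : H) (k : nat) := false.
have code_inj i j : L i = L j -> (forall k, (k < L i)%N -> c i k = c j k) -> i = j.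
  rewrite /L => Lij _; apply: idx_inj.
  by case: (ltngtP (idx i) (idx j)) => // /level_lt; rewrite Lij ltnn.
have [phi [phi_inj phiE]] := host_embedding code_inj at_minus_oneM at_minus_one_inj
  (fun h => ex_intro _ _ (at_minus_oneE h)).
set gens := host_gens L c half_line translation in phi phi_inj phiE *.
pose Y : set (generated_group gens) := @generators _ gens.
have Ygen : finite_generating Y by apply/generators_finite_generating/finite_host_gens.
exists (host L c half_line translation), phi; split=> //; first by exists Y.
(* Such words meet only letters of index at most [k], so all their values stay in the finite
   subgroup [F k]. *)
have small k r : (r < level k.+1)%N -> (relative_growth Y (range phi) r <= N k)%N.
  move=> rk; rewrite /N -(size_map phi); apply: relative_growth_le_seq => // _ [h _ <-] hr.
  apply: map_f; rewrite in_fset_set // inE.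
  have [F1 FM FV] := Fgrp k.
  have := word_length_generators (phi h); rewrite phiE => Sh.
  suff : forall j, F k (base (base (at_origin (at_minus_one h)) 1) j).
    by move=> /(_ (-1 : int)%R); rewrite base_at_origin eqxx.
  apply: (base_spelled_mem code_inj (P := [set x | forall j, F k (base x j)])) Sh hr.
  - by move=> j.
  - by move=> x y Px Py j; rewrite base_mul; apply: FM.
  - by move=> x Px j; rewrite base_inv; apply: FV.
  - by move=> j.
  - move=> i ir j /=; case: ifP => // _; apply: idxF.
    by rewrite leqNgt; apply/negP => /level_le; rewrite /L in ir; lia.
move=> X Xgen f fD [r0 r0_gt0 fr0] [_ [c1 c1_gt0 fX]].
have [c0 c0_gt0 XY] := word_length_change Ygen Xgen.
(* Superadditivity gives [f (r0 * q) >= q > c1 * N k]. The [X]-radius [c1 * r0 * q] becomes the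
   [Y]-radius [k * q], which is below [level k.+1] because [c1 <= k]. *)
pose k := (c0 * c1 * r0)%N; pose q := (c1 * N k + 1)%N.
have := superadditive_linear fD r0_gt0 (_ : 0 < f r0)%N (_ : 0 < q)%N.
have := fX (r0 * q)%N.
have le : (relative_growth X (range phi) (c1 * (r0 * q)) <= N k)%N.
  apply: leq_trans (small k (k * q)%N _).
    apply: leq_relative_growth => // h _ hr; apply: leq_trans (XY h) _.
    by apply: leq_trans (leq_mul (leqnn c0) hr) _; rewrite /k; lia.
  apply: leq_ltn_trans (levelS k); rewrite /q.
  have c1k : (c1 <= k)%N by rewrite /k -mulnA mulnCA leq_pmulr // muln_gt0 c0_gt0.
  apply: leq_trans (leq_addl _ _); rewrite leq_mul2l leq_add2r leq_mul2r c1k.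
  by rewrite !orbT.
have q_gt0 : (0 < q)%N by rewrite /q addn1.
have fr0_gt0 : (0 < f r0)%N by rewrite lt0n; apply/eqP.
have := superadditive_linear fD r0_gt0 fr0_gt0 q_gt0.
have := fX (r0 * q)%N; rewrite muln_gt0 r0_gt0 q_gt0 => /(_ isT) fq qf.
have := leq_trans qf (leq_trans fq (leq_mul (leqnn c1) le)).
by rewrite /q addn1 ltnn.
Qed.

End LocallyFinite.

(** * Reflections and rotations of a generalized dihedral group *)

Section Dihedral.
Variable H : groupType.
Local Open Scope group_scope.

Definition dihedral := wreath H (additive_group bool).
HB.instance Definition _ := Group.on dihedral.

Definition reflection (h : H) : dihedral :=
  Wreath (fun b : bool => if b then h^-1 else h) true.
Definition swap : dihedral := Wreath (fun=> 1) true.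
Definition square_rotation (h : H) : dihedral :=
  Wreath (fun b : bool => if b then h^-1 * h^-1 else h * h) false.

Lemma reflection_involutive h : reflection h * reflection h = 1.
Proof. by apply: wreath_eq => [[]|] //=; rewrite ?mulVg ?mulgV. Qed.

Lemma swap_involutive : swap * swap = 1.
Proof. by apply: wreath_eq => [[]|] //=; rewrite mulg1. Qed.

(** For involutions the commutator is the square of their product; this is why the rotation by the
    square of [h] appears. *)
Lemma square_rotationE h :
  square_rotation h = reflection h * swap * (reflection h)^-1 * swap^-1.
Proof.
by apply: wreath_eq => [[]|] //=; rewrite !(invg1, mulg1, invgK).
Qed.

Hypothesis HC : commutative (@mul H).

Lemma square_rotationM : {morph square_rotation : x y / x * y}.
Proof.
have sqM (p q : H) : p * q * (p * q) = p * p * (q * q).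
  by rewrite -!mulgA; congr (_ * _); rewrite !mulgA; congr (_ * _); apply: HC.
move=> x y; apply: wreath_eq => [[]|] //=.
by rewrite invgM (HC y^-1); apply: sqM.
Qed.

Lemma solvable_dihedral : solvable_group dihedral.
Proof.
apply: solvable_wreath; apply: solvable_commutative; first exact: HC.
exact: GRing.addrC.
Qed.

End Dihedral.

(** * Binary digits *)

Section BinaryCode.

Definition bit (m k : nat) : bool := odd (m %/ 2 ^ k).

Lemma bit_inj n m m' : m < 2 ^ n -> m' < 2 ^ n ->
  (forall k, k < n -> bit m k = bit m' k) -> m = m'.
Proof.
elim: n m m' => [|n IH] m m'; first by rewrite expn0; lia.
rewrite expnS => mn m'n bits.
have := bits 0 isT; rewrite /bit expn0 !divn1 => E0.
have E : m./2 = m'./2.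
  apply: IH => [||k kn]; [lia | lia |].
  by have := bits k.+1 kn; rewrite /bit expnS !divnMA !divn2.
by rewrite -[m]odd_double_half -[m']odd_double_half E E0.
Qed.

End BinaryCode.

(** * Part (3): infinite cyclic groups *)

Section InfiniteCyclic.
Variables (H : groupType) (a : H).
Hypotheses (Hinf : infinite_set [set: H]) (Ha : generated [set a] = [set: H]).
Local Open Scope group_scope.

(** The absolute value of the exponent of [h] as a power of [a]. *)
Let N (h : H) : nat := word_length [set a] h.

Lemma cyclic_finite_generating : finite_generating [set a].
Proof. by split=> //; apply: finite_set1. Qed.

Lemma cyclic_spelled n h : spelled [set a] n h ->
  exists2 k, (k <= n)%N & h = a ^+ k \/ h = a ^- k.
Proof.
have step k : a ^- k.+1 * a = a ^- k by rewrite expgS invgM mulgVK.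
move: n h; apply: spelled_ind => [|n x h ax _ [k kn hE]].
  by exists 0%N => //; left.
have ca m : commute a (a ^- m) by apply/commuteV/commuteX/commute_refl.
have {ax} [->|->] : x = a \/ x = a^-1.
  by case: ax => /= [->|E]; [left | right; rewrite -E invgK].
- case: hE => ->; first by exists k.+1; [lia | left; rewrite expgS].
  case: k kn => [|k] kn; first by exists 1%N; [lia | left; rewrite expg0 invg1 mulg1].
  by exists k; [lia | right; rewrite ca step].
- case: hE => ->; last by exists k.+1; [lia | right; rewrite expgSr invgM].
  case: k kn => [|k] kn; first by exists 1%N; [lia | right; rewrite expg0 mulg1].
  by exists k; [lia | left; rewrite expgS mulKg].
Qed.

Lemma cyclic_normal_form h : h = a ^+ N h \/ h = a ^- N h.
Proof.
have [k kN hE] := cyclic_spelled (spelled_word_length cyclic_finite_generating h).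
suff -> : N h = k by [].
apply/eqP; rewrite eqn_leq kN andbT.
have aX : spelled [set a] k (a ^+ k).
  elim: (k) => [|j IH]; first exact: spelled1.
  by rewrite expgS; apply: spelledS => //; left.
by apply: word_length_le; case: hE => ->; last apply: spelledV.
Qed.

Lemma infinite_cyclic_torsion_free k : a ^+ k = 1 -> k = 0%N.
Proof.
move=> ak; apply/eqP; rewrite -leqn0 leqNgt; apply/negP => k0; apply: Hinf.
have aP m : [set a ^+ i | i in `I_k] (a ^+ m).
  exists (m %% k)%N; first by rewrite /= ltn_mod.
  by rewrite [in RHS](divn_eq m k) expgnDr mulnC expgnA ak expg1n mul1g.
apply: (sub_finite_set
  (B := [set a ^+ i | i in `I_k] `|` [set x^-1 | x in [set a ^+ i | i in `I_k]])).
  move=> h _; case: (cyclic_normal_form h) => ->; [left | right]; first exact: aP.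
  by exists (a ^+ N h).
rewrite finite_setU; split; first exact: finite_image.
by apply: finite_image; apply: finite_image.
Qed.

Lemma cyclic_commutative : commutative (@mul H).
Proof.
move=> x y; have ca k l : commute (a ^+ k) (a ^+ l) by apply/commuteX2/commute_refl.
have cx k : commute (a ^+ k) y.
  by case: (cyclic_normal_form y) => ->; last apply: commuteV.
case: (cyclic_normal_form x) => ->; first exact: cx.
by apply: commute_sym; apply: commuteV; apply: commute_sym.
Qed.

Lemma expg_inj : injective (fun k => a ^+ k).
Proof.
move=> i j; wlog ij : i j / (i <= j)%N.
  by move=> W E; case: (leqP i j) => [/W|/ltnW/W]; [apply | move=> ->].
move=> /= E; have := expgnFr a ij; rewrite E mulgV => /infinite_cyclic_torsion_free.
by lia.
Qed.

Lemma expg_expV_eq i j : a ^+ i = a ^- j -> (i + j = 0)%N.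
Proof.
by move=> E; apply: infinite_cyclic_torsion_free; rewrite expgnDr E mulVg.
Qed.

Lemma N_sqr h : N (h * h) = (N h).*2.
Proof.
have E k : a ^+ k * a ^+ k = a ^+ k.*2 by rewrite -expgnDr addnn.
have hh : h * h = a ^+ (N h).*2 \/ h * h = a ^- (N h).*2.
  have [hE|hE] := cyclic_normal_form h; [left | right]; rewrite {1 2}hE //.
  by rewrite -invgM E.
case: hh => hh; case: (cyclic_normal_form (h * h)) => hh'; move: hh' hh; 
  set n := N (h * h) => -> /=; first by move/expg_inj.
- by move=> /esym/expg_expV_eq; lia.
- by move/expg_expV_eq; lia.
- by move/invg_inj/expg_inj.
Qed.

Lemma square_rotation_inj : injective (@square_rotation H).
Proof.
move=> x y /(congr1 (fun g => base g false)) /= E.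
have : N ((x / y) * (x / y)) = 0%N.
  rewrite -mulgA (cyclic_commutative y^-1) -!mulgA -invgM -E mulgA invgM.
  by rewrite mulgA mulgK mulgV /N word_length1.
rewrite N_sqr => n0; apply/eqP; rewrite -divg_eq1; apply/eqP.
have {n0} N0 : N (x / y) = 0%N by lia.
by case: (cyclic_normal_form (x / y)); rewrite N0 ?invg1 => ->.
Qed.

Section Growth.
Variables (f : nat -> nat) (r0 D : nat).
Hypotheses (fD : superadditive f) (r0_gt0 : (0 < r0)%N) (fr0 : (0 < f r0)%N).
Hypothesis f_lt : forall r, (0 < r)%N -> (2 * f r + 1 < 2 ^ (D * r))%N.

(** The value of [f] at 0 is arbitrary; with 0 there, superadditivity extends to all arguments and
    the identity gets length 0. *)
Definition zero_ext (r : nat) : nat := if r is 0 then 0%N else f r.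

Lemma zero_ext_mono r s : (r <= s)%N -> (zero_ext r <= zero_ext s)%N.
Proof. by case: r => [|r] // ; case: s => // s rs; apply: (superadditive_mono fD). Qed.

Lemma zero_extD r s : (zero_ext r + zero_ext s <= zero_ext (r + s))%N.
Proof.
by case: r s => [|r] [|s]; rewrite ?addn0 ?add0n //; apply: (@fD r.+1 s.+1).
Qed.

Lemma zero_ext_unbounded h : exists r, (N h <= zero_ext r)%N.
Proof.
exists (r0 * (N h).+1)%N; have : (0 < r0 * (N h).+1)%N by rewrite muln_gt0 r0_gt0.
have := superadditive_linear fD r0_gt0 fr0 (ltn0Sn (N h)).
by rewrite /zero_ext; case: (r0 * _)%N => //; lia.
Qed.

(* Superadditivity of [f] makes this a length function on [H], and its ball of
   radius [r] has about [2 * f r] elements. *)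
Definition f_length h : nat := ex_minn (zero_ext_unbounded h).

Lemma f_length_le h r : (f_length h <= r)%N = (N h <= zero_ext r)%N.
Proof.
rewrite /f_length; case: ex_minnP => m hm mmin; apply/idP/idP => [mr|/mmin //].
by apply: leq_trans hm (zero_ext_mono mr).
Qed.

Lemma N_le_f_length h : (N h <= zero_ext (f_length h))%N.
Proof. by rewrite -f_length_le. Qed.

Lemma f_length1 : f_length 1 = 0%N.
Proof. by apply/eqP; rewrite -leqn0 f_length_le /N word_length1. Qed.

Lemma f_lengthM x y : (f_length (x * y) <= f_length x + f_length y)%N.
Proof.
rewrite f_length_le; apply: leq_trans (word_lengthM cyclic_finite_generating _ _) _.
apply: leq_trans (zero_extD _ _); exact: leq_add (N_le_f_length _) (N_le_f_length _).
Qed.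

Lemma f_lengthV x : f_length x^-1 = f_length x.
Proof.
have NV y : N y^-1 = N y by apply: word_lengthV cyclic_finite_generating _.
apply/eqP; rewrite eqn_leq !f_length_le NV N_le_f_length /=.
by rewrite -(NV x) N_le_f_length.
Qed.

Let L h := (D * f_length h)%N.
(** Absolute value and sign of the exponent in one number; the factor [D] in [L] makes it fit into
    [L h] binary digits. *)
Let index h : nat := (2 * N h + (h != a ^+ N h))%N.
Let c h := bit (index h).

Lemma index_lt h : (index h < 2 ^ L h)%N.
Proof.
rewrite /index /L; have := N_le_f_length h; case: (f_length h) => [|r] Nh.
  have N0 : N h = 0%N by move: Nh => /=; lia.
  have -> : h == a ^+ N h.
    by case: (cyclic_normal_form h); rewrite N0 expg0 ?invg1 => ->.
  by rewrite N0 !muln0.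
apply: leq_ltn_trans (f_lt (ltn0Sn r)); move: Nh => /=; case: (h != _); lia.
Qed.

Lemma cyclic_code_inj h k : L h = L k -> (forall i, (i < L h)%N -> c h i = c k i) -> h = k.
Proof.
move=> Lhk /(bit_inj (index_lt h)); rewrite Lhk => /(_ (index_lt k)); rewrite /index => E.
have Nhk : N h = N k by move: E; case: (h != _); case: (k != _); lia.
have := cyclic_normal_form h; have := cyclic_normal_form k; move: E; rewrite Nhk.
case: eqP => hE; case: eqP => kE; [|lia|lia|].
  by move=> _ _ _; rewrite hE; apply: esym.
by move=> _ [/kE //|kV] [/hE //|hV]; rewrite hV; apply: esym.
Qed.

Lemma cyclic_embedding : exists (G : groupType) (phi : {multiplicative H -> G}),
  [/\ finitely_generated G, solvable_group G, injective phi &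
    forall X : set G, finite_generating X ->
      growth_approx (relative_growth X (range phi)) f].
Proof.
have HC := cyclic_commutative.
have [phi [phi_inj phiE]] := host_embedding cyclic_code_inj (square_rotationM HC)
  square_rotation_inj (fun h => ex_intro _ h (square_rotationE h)).
set gens := host_gens L c (@reflection H) (swap H) in phi phi_inj phiE *.
pose Y : set (generated_group gens) := @generators _ gens.
have Ygen : finite_generating Y by apply/generators_finite_generating/finite_host_gens.
exists (host L c (@reflection H) (swap H)), phi; split=> //; first by exists Y.
  apply: (solvable_injective (f := val : generated_group gens -> _) val_inj).
  apply: solvable_wreath; first exact: solvable_dihedral.
  exact: solvable_lamplighter.
have upper h : (word_length Y (phi h) <= 24 * L h + 16)%N.
  have [n nL] := spelled_at_origin cyclic_code_inj (@reflection H) (swap H) h.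
  rewrite -square_rotationE -phiE => Sn.
  by apply: leq_trans nL; apply/word_length_le/spelled_generators.
have lower h : (N h <= zero_ext (word_length Y (phi h)))%N.
  (* The reflection of [h] has [lam] equal to [2 * L h], hence the constant 2 below, and [swap] has
     [lam] 0. Passing from [h] to [h * h] only doubles the exponent, so the bound for the square
     also bounds [N h]. *)
  pose lam (g : dihedral H) := (D * (f_length (base g false) + f_length (base g true)))%N.
  have := word_length_generators (phi h); rewrite phiE => Sh.
  have le2 : (lam (base (at_origin (square_rotation h)) 1%g) <= 2 * word_length Y (phi h))%N.
    apply: (base_spelled_lam cyclic_code_inj (v := @reflection H) (u := swap H)) Sh => //.
    - by rewrite /lam !wreathE f_length1 muln0.
    - move=> x y.
      have le : (lam (x * y)%g <= D * (f_length (base x false) + f_length (base y (top x))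
          + (f_length (base x true) + f_length (base y (~~ top x)))))%N.
        by rewrite leq_mul2l leq_add ?orbT //; apply: f_lengthM.
      apply: leq_trans le _; rewrite /lam -mulnDr leq_mul2l; apply/orP; right.
      by case: (top x); rewrite [~~ _]/=; lia.
    - by rewrite /lam /= f_length1 muln0.
    - exact: swap_involutive.
    - by move=> i; rewrite /lam /= f_lengthV /L; lia.
    - exact: reflection_involutive.
  have D_gt0 : (0 < D)%N by case: (D) (f_lt (ltn0Sn 0)) => //; lia.
  have {}le2 : (D * (f_length (h * h) + f_length (h * h)) <= 2 * word_length Y (phi h))%N.
    by move: le2; rewrite base_at_origin eqxx /lam /= -invgM f_lengthV.
  have : (f_length (h * h) <= word_length Y (phi h))%N by nia.
  by rewrite f_length_le N_sqr; lia.
move=> X Xgen; have [c1 c1_gt0 XY] := word_length_change Xgen Ygen.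
have [c2 c2_gt0 YX] := word_length_change Ygen Xgen.
split.
  exists (4 * c2 * r0)%N; first by lia.
  (* The factor [r0] ensures [f R > 0], so that the [2 * (f R + 1)] listed elements number at most
     [4 * f R]. *)
  move=> r r_gt0; pose R := (c2 * r * r0)%N.
  have fR : (0 < f R)%N.
    apply: leq_trans fr0 _; apply: (superadditive_mono fD r0_gt0).
    by rewrite leq_pmull // muln_gt0 c2_gt0.
  have R_gt0 : (0 < R)%N by rewrite !muln_gt0 c2_gt0 r_gt0.
  pose s := iota 0 (f R).+1.
  pose T := [seq phi (a ^+ k) | k <- s] ++ [seq phi (a ^- k) | k <- s].
  apply: (@leq_trans (size T)); last first.
    rewrite size_cat !size_map size_iota.
    have fR4 : (f R <= f (4 * c2 * r0 * r))%N.
      apply: (superadditive_mono fD R_gt0).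
      have -> : (4 * c2 * r0 * r = 4 * R)%N by rewrite /R; lia.
      exact: leq_pmull.
    have c_gt0 : (0 < c2 * r0)%N by rewrite muln_gt0 c2_gt0.
    apply: (@leq_trans (4 * f R)%N); first by lia.
    by apply: leq_mul fR4; rewrite -mulnA leq_pmulr.
  apply: relative_growth_le_seq => // _ [h _ <-] hr.
  have Nh : (N h <= f R)%N.
    apply: leq_trans (lower h) _; have -> : f R = zero_ext R.
      by case: (R) R_gt0.
    apply: zero_ext_mono; apply: leq_trans (YX _) _.
    by apply: leq_trans (leq_mul (leqnn c2) hr) _; apply: leq_pmulr.
  rewrite /T mem_cat; case: (cyclic_normal_form h) => hE; apply/orP; [left|right];
    by apply/mapP; exists (N h); rewrite ?mem_iota ?ltnS -?hE.
(* The powers [a ^+ k] with [1 <= k <= f r] have [f_length] at most [r], hence [Y]-length at most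
   [24 * D * r + 16]. *)
exists (c1 * (24 * D + 16))%N; first by lia.
move=> r r_gt0; set c3 := (c1 * _)%N.
suff : (f r <= relative_growth X (range phi) (c3 * r))%N by nia.
rewrite -[f r](size_iota 1) -(size_map (fun k => phi (a ^+ k))).
apply: seq_le_relative_growth => //.
  by rewrite map_inj_uniq ?iota_uniq // => i j /phi_inj/expg_inj.
move=> _ /mapP[k + ->]; rewrite mem_iota => kr; split; first by exists (a ^+ k).
apply: leq_trans (XY _) _; rewrite /c3 -mulnA leq_mul2l; apply/orP; right.
apply: leq_trans (upper _) _.
have : (f_length (a ^+ k) <= r)%N.
  rewrite f_length_le; apply: (@leq_trans k); last by case: (r) r_gt0 kr => //=; lia.
  apply: word_length_le; elim: (k) => [|i IH]; first exact: spelled1.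
  by rewrite expgS; apply: spelledS => //; left.
by rewrite /L; nia.
Qed.

End Growth.

End InfiniteCyclic.

(** * The exponential bound and the three parts together *)

Lemma expn_bound (f : nat -> nat) : growth_preceq f (fun r => 2 ^ r) ->
  exists D, forall r, 0 < r -> 2 * f r + 1 < 2 ^ (D * r).
Proof.
(* With [p = 2 ^ (c * r)] and [q = 2 ^ r] the right side is [(p * q) ^ 2], at least [4 * p * p];
   since [c < p], this exceeds [2 * c * p + 1]. *)
move=> [c _ fc]; exists (2 * c + 2) => r r0; have {}fc := fc r r0.
have cr : c < 2 ^ (c * r).
  by apply: leq_trans (ltn_expl c (ltnSn 1)) _; rewrite leq_exp2l // leq_pmulr.
have two : 2 <= 2 ^ r by rewrite -{1}[2]expn1 leq_exp2l.
have -> : (2 * c + 2) * r = (c * r + r) + (c * r + r) by lia.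
rewrite !expnD; move: fc cr two; set p := 2 ^ (c * r); set q := 2 ^ r.
move=> fc cp q2; apply: (@leq_ltn_trans (2 * (c * p) + 1)); first by lia.
have : c.+1 * p <= p * p by rewrite leq_mul2r cp orbT.
have : 4 * (p * p) <= p * q * (p * q) by rewrite mulnACA mulnC leq_mul // (leq_mul q2 q2).
by lia.
Qed.

Theorem theorem2p1 :
  (forall (G : groupType) (H : set G),
     finitely_generated G ->
     group_closed [in H] ->
     ~ locally_finite H ->
     forall X : set G, finite_generating X ->
     exists f : nat -> nat,
       [/\ positive_valued f, superadditive f &
           growth_sim (relative_growth X H) f])
  /\
  (forall H : groupType,
     ([set: H] #= [set: nat])%card ->
     locally_finite [set: H] ->
     exists (G : groupType) (phi : {multiplicative H -> G}),
       [/\ finitely_generated G, injective phi &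
           forall X : set G, finite_generating X ->
           forall f : nat -> nat, superadditive f -> nonzero_fun f ->
             ~ growth_approx (relative_growth X (range phi)) f])
  /\
  (forall (H : groupType) (f : nat -> nat),
     infinite_set [set: H] -> cyclic_group H ->
     superadditive f -> nonzero_fun f ->
     growth_preceq f (fun r => 2 ^ r) ->
     exists (G : groupType) (phi : {multiplicative H -> G}),
       [/\ finitely_generated G, solvable_group G, injective phi &
           forall X : set G, finite_generating X ->
             growth_approx (relative_growth X (range phi)) f]).
Proof.
split=> [G H _ Hgroup Hnlf X Xgen|].
  have [m window] := element_of_length_about Xgen Hgroup Hnlf.
  exact: (relative_growth_sim_superadditive Xgen Hgroup window).
split=> [H Hcard Hlf|H f Hinf [a Ha] fD [r0 r0_gt0 fr0] /expn_bound[D fexp]].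
  by apply: locally_finite_embedding Hlf; rewrite /countable (card_le_eql Hcard).
by apply: (cyclic_embedding Hinf Ha fD r0_gt0 _ fexp); rewrite lt0n; apply/eqP.
Qed.
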